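(* Let $(\mathrm{G},\mu)$ be a Lorentzian Lie group, with Lie algebra $\mathfrak{g}$ and inner product $\langle\cdot,\cdot\rangle=\mu(e)$ on $\mathfrak{g}$. Then $\mu$ is flat and $\mathrm{G}$ carries a timelike left-invariant Killing vector field if and only if $\mathfrak{g}$ splits as a $\langle\cdot,\cdot\rangle$-orthogonal direct sum $\mathfrak{g}=S(\mathfrak{g})\oplus[\mathfrak{g},\mathfrak{g}]$, where $[\mathfrak{g},\mathfrak{g}]$ is abelian, and $S(\mathfrak{g})$ is abelian and contains a timelike vector (i.e. some $u\in S(\mathfrak{g})$ with $\langle u,u\rangle<0$). Moreover, in this case the dimension of $[\mathfrak{g},\mathfrak{g}]$ is even and the Levi-Civita product is given by $\mathrm{L}_a=\mathrm{ad}_a$ if $a\in S(\mathfrak{g})$ and $\mathrm{L}_a=0$ if $a\in[\mathfrak{g},\mathfrak{g}]$.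
   Context: A Lorentzian Lie group is a Lie group $\mathrm{G}$ with a left-invariant pseudo-Riemannian metric $\mu$ of signature $(-,+,\dots,+)$. The Levi-Civita connection of $\mu$ defines a product $(u,v)\mapsto uv$ on $\mathfrak{g}$ (the Levi-Civita product) by $2\langle uv,w\rangle=\langle[u,v],w\rangle-\langle[v,w],u\rangle+\langle[w,u],v\rangle$; $\mathrm{L}_u(v)=uv$. The metric is flat iff the curvature $K(u,v)=\mathrm{L}_{[u,v]}-[\mathrm{L}_u,\mathrm{L}_v]$ vanishes identically. $S(\mathfrak{g})=\{u\in\mathfrak{g}:\mathrm{ad}_u+\mathrm{ad}_u^*=0\}$, where $\mathrm{ad}_u^*$ is the adjoint of $\mathrm{ad}_u$ with respect to $\langle\cdot,\cdot\rangle$; a left-invariant vector field $X$ is Killing iff $X(e)\in S(\mathfrak{g})$. A vector field $X$ is timelike if $\mu(X,X)<0$ everywhere. *)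

(* Defs.v *)
(* Algebraic (Lie-algebra level) formalization of left-invariant
   Lorentzian metrics on a Lie group: g = 'rV[R]_n.+1, bracket [.,.] = br,
   inner product <u,v> = u M v^T. *)
From HB Require Import structures.
From mathcomp Require Import all_boot all_order all_algebra.
Set Implicit Arguments. Unset Strict Implicit. Unset Printing Implicit Defensive.
Import Order.TTheory GRing.Theory Num.Theory.
Local Open Scope ring_scope.

Section Lorentz.
Variables (R : rcfType) (n : nat).
Notation V := 'rV[R]_n.+1.

Definition is_lie_bracket (br : V -> V -> V) : Prop :=
  [/\ (forall (a : R) (u v w : V), br (a *: u + v) w = a *: br u w + br v w),
      (forall u v : V, br u v = - br v u) &
      (forall u v w : V, br u (br v w) + br v (br w u) + br w (br u v) = 0)].

Definition ip (M : 'M[R]_n.+1) (u v : V) : R := (u *m M *m v^T) 0 0.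

Definition lorentz_diag : 'M[R]_n.+1 :=
  diag_mx (\row_(i < n.+1) (if i == ord0 then -1 else 1)).

Definition is_lorentzian (M : 'M[R]_n.+1) : Prop :=
  M^T = M /\ exists P : 'M[R]_n.+1, P \in unitmx /\ P *m M *m P^T = lorentz_diag.

Definition evec (j : 'I_n.+1) : V := delta_mx 0 j.

(* Levi-Civita product: the unique uv with
   2<uv,w> = <[u,v],w> - <[v,w],u> + <[w,u],v> for all w *)
Definition lc_rhs br M (u v w : V) : R :=
  2^-1 * (ip M (br u v) w - ip M (br v w) u + ip M (br w u) v).

Definition LC br M (u v : V) : V :=
  (\row_(j < n.+1) lc_rhs br M u v (evec j)) *m invmx M.

Definition curv br M (u v w : V) : V :=
  LC br M (br u v) w - (LC br M u (LC br M v w) - LC br M v (LC br M u w)).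

Definition is_flat br M : Prop := forall u v w : V, curv br M u v w = 0.

(* S(g) = { u | ad_u + ad_u^* = 0 }, ad_u^* the <.,.>-adjoint of ad_u, i.e.
   <ad_u v, w> + <v, ad_u w> = 0 for all v, w *)
Definition inS br M (u : V) : Prop :=
  forall v w : V, ip M (br u v) w + ip M v (br u w) = 0.

Definition derived (br : V -> V -> V) : 'M[R]_n.+1 :=
  (\sum_(i < n.+1) \sum_(j < n.+1) <<br (evec i) (evec j)>>)%MS.

Definition inD br (x : V) : Prop := (x <= derived br)%MS.

End Lorentz.

(* Main.v *)
(** The algebraic core is a theorem of Milnor: a product on a Euclidean space
    that is skew, torsion-free and flat satisfies [(x y) z = 0]. Indeed
    [K = ker L] is a left ideal, and on its orthogonal [W] the form
    [- tr (L_x L_y)] is invariant and positive definite; its Casimir operator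
    shows that the identity, a 1-cocycle of [W] with values in [L], can only
    exist if [W W = 0].

    In the Lorentzian case a timelike left-invariant Killing vector [s] is
    parallel, so the Levi-Civita product is also skew for the Euclidean product
    obtained from [M] by flipping the sign along [s], and the core applies. Then
    [S(g) = {s | x s = 0 for all x}] is the orthogonal of [[g, g]], because
    [<x s, x s> = - <(x s) s, x>] for [s] in [S(g)], and
    [<x s, x s> = - <s, [x, x s]>] for [s] orthogonal to [[g, g]].

    Evenness: [S(g)] acts on the Euclidean space [[g, g]] by commuting skew
    operators without common kernel, and skew matrices have even rank. *)
Require Import Defs.
From HB Require Import structures.
From mathcomp Require Import all_boot all_order all_algebra.
From mathcomp Require Import ring lra zify.
Set Implicit Arguments. Unset Strict Implicit. Unset Printing Implicit Defensive.
Import Order.TTheory GRing.Theory Num.Theory.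
Local Open Scope ring_scope.

(** * Linear maps as matrices, and the even rank of skew matrices *)

Lemma mul_lin1_mx (R : comNzRingType) m p (f : 'rV[R]_m -> 'rV[R]_p) x :
  linear f -> x *m lin1_mx f = f x.
Proof.
move=> f_lin.
pose F : {linear 'rV[R]_m -> 'rV[R]_p} :=
  HB.pack f (GRing.isLinear.Build _ _ _ _ f f_lin).
exact: (mul_rV_lin1 F).
Qed.

Lemma scalar_sum (R : comNzRingType) m (f : 'rV[R]_m -> R) x :
  scalar f -> f x = \sum_i x 0 i * f (delta_mx 0 i).
Proof.
move=> f_lin.
pose F : {scalar 'rV[R]_m} := HB.pack f (GRing.isLinear.Build _ _ _ _ f f_lin).
rewrite {1}(row_sum_delta x) -[f]/(F : _ -> _) linear_sum.
by apply: eq_bigr => i _; rewrite linearZ.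
Qed.

(** Comparing the determinants of [G^T] and [- G] gives [\det G = - \det G] for odd [r]. *)
Lemma skew_unit_even (R : numFieldType) r (G : 'M[R]_r) :
  G^T = - G -> G \in unitmx -> ~~ odd r.
Proof.
move=> skG; rewrite unitmxE unitfE; apply: contraNN => odd_r.
have := det_tr G; rewrite skG -scaleN1r detZ -signr_odd odd_r expr1 mulN1r.
by move/eqP; rewrite eqNr.
Qed.

(** Skewness puts the columns of [X] in the row space of [Y], which turns the rank factorization
    [F = X Y] into [F = Y^T G^T Y], where [G] is invertible and skew of size [\rank F]. *)
Lemma skew_rank_even (R : numFieldType) r (F : 'M[R]_r) :
  F^T = - F -> ~~ odd (\rank F).
Proof.
move=> skF; set X := col_base F; set Y := row_base F.
have XY : X *m Y = F := mulmx_base F.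
have Xfree : row_free X^T by rewrite -row_leq_rank mxrank_tr (eqP (col_base_full F)).
have Yfree : row_free Y := row_base_free F.
have XTY : (X^T <= Y)%MS.
  have /row_fullP[Z ZY] : row_full Y^T by rewrite /row_full mxrank_tr.
  rewrite eq_row_base -[X^T]mul1mx -ZY -mulmxA -trmx_mul XY skF mulmxN.
  by rewrite eqmx_opp submxMl.
case/submxP: XTY => G XG.
have Gu : G \in unitmx.
  rewrite -row_free_unit -row_leq_rank; apply: leq_trans (mxrankM_maxl G Y).
  by rewrite -XG row_leq_rank.
apply: (skew_unit_even _ Gu).
have XE : X = Y^T *m G^T by rewrite -trmx_mul -XG trmxK.
have FE : F = Y^T *m (G^T *m Y) by rewrite mulmxA -XE XY.
have : Y^T *m ((G^T + G) *m Y) = 0.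
  rewrite mulmxDl mulmxDr -FE.
  have -> : Y^T *m (G *m Y) = F^T by rewrite (congr1 trmx FE) !trmx_mul !trmxK mulmxA.
  by rewrite skF addrN.
have /row_fullP[Z ZY] : row_full Y^T by rewrite /row_full mxrank_tr.
move/(congr1 (mulmx Z)); rewrite mulmxA ZY mul1mx mulmx0.
move/(congr1 (mulmx^~ Z^T)); rewrite -mulmxA -[Y *m _]trmxK trmx_mul trmxK ZY.
by rewrite trmx1 mulmx1 mul0mx => /eqP; rewrite addr_eq0 => /eqP.
Qed.

(** * Orthonormal frames, projections and commuting skew operators *)

Section InnerProduct.
Variables (R : rcfType) (n : nat).
Notation V := 'rV[R]_n.+1.
Implicit Types (M : 'M[R]_n.+1) (u v w x y : V).

Lemma ipDl M u v w : ip M (u + v) w = ip M u w + ip M v w.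
Proof. by rewrite /ip !mulmxDl mxE. Qed.
Lemma ipDr M u v w : ip M w (u + v) = ip M w u + ip M w v.
Proof. by rewrite /ip linearD /= !mulmxDr mxE. Qed.
Lemma ipZl M a u v : ip M (a *: u) v = a * ip M u v.
Proof. by rewrite /ip -!scalemxAl mxE. Qed.
Lemma ipZr M a u v : ip M u (a *: v) = a * ip M u v.
Proof. by rewrite /ip linearZ /= -!scalemxAr mxE. Qed.
Lemma ipNl M u v : ip M (- u) v = - ip M u v.
Proof. by rewrite -scaleN1r ipZl mulN1r. Qed.
Lemma ipNr M u v : ip M u (- v) = - ip M u v.
Proof. by rewrite -scaleN1r ipZr mulN1r. Qed.
Lemma ip0l M u : ip M 0 u = 0.
Proof. by rewrite -(scale0r 0) ipZl mul0r. Qed.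
Lemma ip0r M u : ip M u 0 = 0.
Proof. by rewrite -(scale0r 0) ipZr mul0r. Qed.
Lemma ip_suml M u I (r : seq I) (F : I -> V) :
  ip M (\sum_(i <- r) F i) u = \sum_(i <- r) ip M (F i) u.
Proof.
elim: r => [|i r IHr]; first by rewrite !big_nil ip0l.
by rewrite !big_cons ipDl IHr.
Qed.
Definition ipE := (ipDl, ipDr, ipNl, ipNr, ipZl, ipZr, ip0l, ip0r).

Lemma ipC M u v : M^T = M -> ip M u v = ip M v u.
Proof.
move=> Msym; rewrite /ip -[u *m M *m v^T]trmxK mxE.
by rewrite !trmx_mul trmxK Msym mulmxA.
Qed.

Lemma mulmx_gramE M p q (A : 'M_(p, n.+1)) (B : 'M_(q, n.+1)) i j :
  (A *m M *m B^T) i j = ip M (row i A) (row j B).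
Proof.
by rewrite /ip tr_row -row_mul !mxE; apply: eq_bigr => k _; rewrite !mxE.
Qed.

Lemma ip_matrix (b : V -> V -> R) x y :
  (forall v, scalar (b^~ v)) -> (forall u, scalar (b u)) ->
  ip (\matrix_(i, j) b (delta_mx 0 i) (delta_mx 0 j)) x y = b x y.
Proof.
move=> bl br; rewrite (scalar_sum x (bl y)) /ip -mulmxA mxE.
apply: eq_bigr => i _; rewrite (scalar_sum y (br _)) mxE; congr (_ * _).
by apply: eq_bigr => j _; rewrite !mxE mulrC.
Qed.

(** The form [M] may be indefinite outside the row space of [W]. *)
Definition pos_on M p (W : 'M[R]_(p, n.+1)) :=
  forall x, (x <= W)%MS -> x != 0 -> 0 < ip M x x.

Lemma pos_on_eq0 M p (W : 'M_(p, n.+1)) x :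
  pos_on M W -> (x <= W)%MS -> ip M x x = 0 -> x = 0.
Proof.
by move=> Mpos xW xx0; apply/eqP/negPn/negP => /(Mpos _ xW); rewrite xx0 ltxx.
Qed.

Lemma pos_on_ge0 M p (W : 'M_(p, n.+1)) x :
  pos_on M W -> (x <= W)%MS -> 0 <= ip M x x.
Proof.
move=> Mpos xW; have [->|/(Mpos _ xW)/ltW//] := eqVneq x 0.
by rewrite ip0l.
Qed.

(** Gram-Schmidt. The last clause expresses that [E] spans [W], through the orthogonal projection
    [X *m M *m E^T *m E]. *)
Lemma orthonormal_frame M p (W : 'M_(p, n.+1)) :
  M^T = M -> pos_on M W ->
  exists r, exists E : 'M[R]_(r, n.+1),
    [/\ (E <= W)%MS, E *m M *m E^T = 1%:M &
        forall q (X : 'M_(q, n.+1)), (X <= W)%MS -> X *m M *m E^T *m E = X].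
Proof.
move=> Msym Mpos; exists (\rank W).
have partial k : (k <= \rank W)%N ->
    exists E : 'M[R]_(k, n.+1), (E <= W)%MS /\ E *m M *m E^T = 1%:M.
  elim: k => [|k IHk] ltkr.
    by exists 0; split; [rewrite sub0mx | apply/matrixP; case].
  have [E [EW EE]] := IHk (ltnW ltkr).
  set T := row_base W *m (M *m E^T).
  (* [T] has [\rank W] rows but only [k] columns, so some nonzero vector of [W] is orthogonal to the
     rows of [E]. *)
  have : (kermx T != 0)%MS.
    rewrite -mxrank_eq0 mxrank_ker subn_eq0 -ltnNge.
    exact: leq_ltn_trans (rank_leq_col T) ltkr.
  case/rowV0Pn=> c /sub_kermxP cT c0.
  set x := c *m row_base W.
  have xW : (x <= W)%MS by rewrite -(eq_row_base W) submxMl.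
  have x0 : x != 0.
    apply: contra_neq c0 => cW0; apply: (row_free_inj (row_base_free W)).
    by rewrite mul0mx.
  have xE : x *m M *m E^T = 0 by rewrite -mulmxA /x -mulmxA.
  have xx := Mpos _ xW x0.
  pose y := (Num.sqrt (ip M x x))^-1 *: x.
  have yE : y *m M *m E^T = 0 by rewrite -!scalemxAl xE scaler0.
  have yy : y *m M *m y^T = 1%:M.
    rewrite [LHS]mx11_scalar -/(ip M y y) ipZl ipZr mulrA -invfM -expr2.
    by rewrite sqr_sqrtr ?ltW // mulVf ?gt_eqF.
  have Ey : E *m M *m y^T = 0.
    by apply: (can_inj (@trmxK _ _ _)); rewrite !trmx_mul trmxK Msym mulmxA yE trmx0.
  pose E' : 'M_(k + 1, _) := col_mx E y.
  have E'W : (E' <= W)%MS.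
    by rewrite -addsmxE addsmx_sub EW scalemx_sub.
  have E'E : E' *m M *m E'^T = 1%:M.
    rewrite /E' tr_col_mx mul_col_mx mul_col_row EE yE Ey yy.
    by rewrite -scalar_mx_block.
  by move: E' E'W E'E; rewrite addn1 => E' *; exists E'.
have [E [EW EE]] := partial _ (leqnn _); exists E; split=> //.
have Efree : row_free E by apply/row_freeP; exists (M *m E^T); rewrite mulmxA.
have WE : (W <= E)%MS by rewrite -(mxrank_leqif_sup EW) (eqP Efree).
move=> q X /submx_trans/(_ WE)/submxP[C ->].
by rewrite -(mulmxA C E M) -(mulmxA C) EE mulmx1.
Qed.

Lemma projection_split M p (W : 'M_(p, n.+1)) x :
  M^T = M -> pos_on M W ->
  exists s d, [/\ (d <= W)%MS, x = s + d & forall y, (y <= W)%MS -> ip M s y = 0].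
Proof.
move=> Msym Mpos; have [r [E [EW EE WE]]] := orthonormal_frame Msym Mpos.
pose d := x *m M *m E^T *m E.
have dW : (d <= W)%MS by apply: mulmx_sub.
exists (x - d), d; split; rewrite ?subrK // => y /WE <-.
rewrite /ip 3!trmx_mul !mulmxA; set A := _ *m M *m E^T.
suff -> : A = 0 by rewrite !mul0mx mxE.
by rewrite /A !mulmxBl /d -(mulmxA _ E M) -(mulmxA _ (E *m M)) EE mulmx1 subrr.
Qed.

(** By induction on [As]: [A] contributes the rank of a skew matrix, and the other operators
    preserve [W :&: kermx A] because they commute with [A] on [W]. *)
Lemma commuting_skew_even M (W : 'M_n.+1) (As : seq 'M[R]_n.+1) :
  M^T = M -> pos_on M W ->
  (forall A : 'M_n.+1, A \in As -> forall x, (x <= W)%MS -> (x *m A <= W)%MS) ->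
  (forall A : 'M_n.+1, A \in As -> forall x y, (x <= W)%MS -> (y <= W)%MS ->
     ip M (x *m A) y = - ip M x (y *m A)) ->
  (forall A B : 'M_n.+1, A \in As -> B \in As -> forall x, (x <= W)%MS ->
     x *m A *m B = x *m B *m A) ->
  (forall x, (x <= W)%MS -> (forall A : 'M_n.+1, A \in As -> x *m A = 0) -> x = 0) ->
  ~~ odd (\rank W).
Proof.
move=> Msym; elim: As W => [|A As IH] W Mpos stab skew comm ker0.
  suff -> : W = 0 by rewrite mxrank0.
  by apply/row_matrixP => i; rewrite row0; apply: ker0; rewrite ?row_sub.
have hA : A \in A :: As by rewrite mem_head.
have hAs B : B \in As -> B \in A :: As by rewrite inE orbC => ->.
set B := row_base W.
have BW i : (row i B <= W)%MS by rewrite -(eq_row_base W) row_sub.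
(* The Gram matrix of the skew form [<x A, y>] in the basis [B] of [W]. *)
set F := B *m A *m M *m B^T.
have skF : F^T = - F.
  apply/matrixP=> i j; rewrite [LHS]mxE [RHS]mxE /F !mulmx_gramE !(row_mul _ B).
  by rewrite (skew _ hA) // ipC.
have rkF : \rank F = \rank (B *m A).
  apply/eqP; rewrite eqn_leq; apply/andP; split.
    by rewrite /F -mulmxA mxrankM_maxl.
  (* If [c *m F = 0], then [c *m B *m A] lies in [W] and is orthogonal to [W], hence vanishes. *)
  have : (\rank (kermx F) <= \rank (kermx (B *m A)))%N.
    apply: mxrankS; apply/rV_subP => c /sub_kermxP cF; apply/sub_kermxP.
    have cBW : (c *m B <= W)%MS by rewrite -(eq_row_base W) submxMl.
    rewrite mulmxA; apply: (pos_on_eq0 Mpos); first exact: stab.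
    have /submxP[d dE] : (c *m B *m A <= B)%MS by rewrite eq_row_base stab.
    rewrite /ip {2}dE trmx_mul mulmxA.
    have -> : c *m B *m A *m M *m B^T = 0 by rewrite -cF /F !mulmxA.
    by rewrite mul0mx mxE.
  have := rank_leq_row F; have := rank_leq_row (B *m A).
  rewrite !mxrank_ker; lia.
have rkW : \rank W = (\rank F + \rank (W :&: kermx A)%MS)%N.
  rewrite rkF -[LHS](mxrank_mul_ker W A); congr (_ + _)%N.
  by rewrite (eqmxMr A (eq_row_base W)).
rewrite rkW oddD (negPf (skew_rank_even skF)) /=; apply: IH.
- by move=> x; rewrite sub_capmx => /andP[/Mpos].
- move=> C /hAs hC x; rewrite !sub_capmx => /andP[xW /sub_kermxP xA].
  by rewrite stab //=; apply/sub_kermxP; rewrite comm // xA mul0mx.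
- by move=> C /hAs hC x y; rewrite !sub_capmx => /andP[xW _] /andP[yW _]; apply: skew.
- by move=> C C' /hAs hC /hAs hC' x; rewrite sub_capmx => /andP[xW _]; apply: comm.
- move=> x; rewrite sub_capmx => /andP[xW /sub_kermxP xA] xAs.
  by apply: ker0 => // C; rewrite inE => /orP[/eqP->|/xAs].
Qed.

End InnerProduct.

(** * Milnor's theorem on flat Euclidean products *)

Section FlatEuclidean.
Variables (R : rcfType) (n : nat).
Notation V := 'rV[R]_n.+1.
Variables (Q : 'M[R]_n.+1) (mul : V -> V -> V).
Hypothesis Qsym : Q^T = Q.
Hypothesis Qpos : pos_on Q (1%:M : 'M[R]_n.+1).
Hypothesis mull : forall z, linear (mul^~ z).
Hypothesis mulr : forall x, linear (mul x).
Hypothesis mul_skew : forall x y z, ip Q (mul x y) z = - ip Q y (mul x z).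
Hypothesis mul_flat : forall x y z,
  mul (mul x y - mul y x) z = mul x (mul y z) - mul y (mul x z).

Local Notation "x · y" := (mul x y) (at level 40, left associativity).
Local Notation "<< x , y >>" := (ip Q x y).
Local Notation bra x y := (x · y - y · x).

Let mulDl x y z : (x + y) · z = x · z + y · z.
Proof. by have := mull z 1 x y; rewrite !scale1r. Qed.
Let mulDr x y z : x · (y + z) = x · y + x · z.
Proof. by have := mulr x 1 y z; rewrite !scale1r. Qed.
Let mul0l z : 0 · z = 0.
Proof. by apply/(addrI (0 · z)); rewrite -mulDl !addr0. Qed.
Let mul0r z : z · 0 = 0.
Proof. by apply/(addrI (z · 0)); rewrite -mulDr !addr0. Qed.
Let mulZl a x z : (a *: x) · z = a *: (x · z).
Proof. by have := mull z a x 0; rewrite mul0l !addr0. Qed.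
Let mulZr a x z : x · (a *: z) = a *: (x · z).
Proof. by have := mulr x a z 0; rewrite mul0r !addr0. Qed.
Let mulBr x y z : x · (y - z) = x · y - x · z.
Proof. by rewrite -scaleN1r mulDr mulZr scaleN1r. Qed.
Let mul_suml z I (r : seq I) (F : I -> V) :
  (\sum_(i <- r) F i) · z = \sum_(i <- r) F i · z.
Proof. exact: (big_morph (mul^~ z) (fun x y => mulDl x y z) (mul0l z)). Qed.
Let mul_sumr z I (r : seq I) (F : I -> V) :
  z · (\sum_(i <- r) F i) = \sum_(i <- r) z · F i.
Proof. exact: (big_morph (mul z) (mulDr z) (mul0r z)). Qed.

Let L x : 'M[R]_n.+1 := lin1_mx (mul x).
Let LE x y : y *m L x = x · y. Proof. exact: mul_lin1_mx. Qed.

Let L_eq x A : (forall y, y *m A = x · y) -> A = L x.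
Proof. by move=> AE; apply/row_matrixP => i; rewrite !rowE LE AE. Qed.

Let L_lin : linear L.
Proof.
move=> a x y; symmetry; apply: L_eq => z.
by rewrite mulmxDr -scalemxAr !LE mulDl mulZl.
Qed.

(** Matrices act on row vectors from the right, which reverses the commutator. *)
Let L_bra x y : L (bra x y) = L y *m L x - L x *m L y.
Proof.
by symmetry; apply: L_eq => z; rewrite mulmxBr !mulmxA !LE mul_flat.
Qed.

Let eq0_norm x : << x, x >> = 0 -> x = 0.
Proof. exact/(pos_on_eq0 Qpos)/submx1. Qed.
Let norm_ge0 x : 0 <= << x, x >>.
Proof. exact/(pos_on_ge0 Qpos)/submx1. Qed.

(** Flattening [L x] by [mxvec] makes the kernel of [L] that of a matrix. *)
Let ker := kermx (lin1_mx (mxvec \o L)).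
Let kerP a : reflect (forall x, a · x = 0) (a <= ker)%MS.
Proof.
have mxvecL_lin : linear (mxvec \o L) by move=> b x y /=; rewrite L_lin linearP.
apply: (iffP sub_kermxP); rewrite mul_lin1_mx //= => a0.
  by move=> x; rewrite -LE -(mxvecK (L a)) a0 linear0 mulmx0.
by rewrite -(L_eq (A := 0)) ?linear0 // => y; rewrite mulmx0 a0.
Qed.

(** Since [L a = 0], the bracket of [x] and [a] is [x · a], and flatness makes [L (x · a)] the
    commutator of [L x] with zero. *)
Let ker_ideal a x : (a <= ker)%MS -> (x · a <= ker)%MS.
Proof.
move=> /kerP a0; apply/kerP => y.
by have := mul_flat x a y; rewrite !a0 subr0 mul0r subr0.
Qed.

(** The trace form of the representation [L]; the sign makes it nonnegative, each [L x] being
    skew. *)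
Let tform x y := - \tr (L x *m L y).
Let B : 'M[R]_n.+1 := \matrix_(i, j) tform (delta_mx 0 i) (delta_mx 0 j).

Let BE x y : ip B x y = tform x y.
Proof.
apply: ip_matrix => [v|u] a x' y'; rewrite /tform L_lin.
  by rewrite mulmxDl -scalemxAl linearD linearZ /= opprD mulrN.
by rewrite mulmxDr -scalemxAr linearD linearZ /= opprD mulrN.
Qed.

Let Bsym : B^T = B.
Proof. by apply/matrixP => i j; rewrite !mxE /tform mxtrace_mulC. Qed.

Let B_inv x y z : ip B (bra x y) z = - ip B y (bra x z).
Proof.
rewrite !BE /tform !L_bra mulmxBl mulmxBr !linearB /= !opprB.
rewrite !mulmxA (mxtrace_mulC (L y *m L x)) (mxtrace_mulC (L y *m L z)) !mulmxA.
by rewrite (mxtrace_mulC (L x *m L y) (L z)) !mulmxA; ring.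
Qed.

(** By skewness, [- \tr (L x *m L x)] is the sum of the squared norms of [x · f] for [f] in a
    [Q]-orthonormal frame. *)
Let B_pos x : 0 <= ip B x x /\ (ip B x x = 0 -> (x <= ker)%MS).
Proof.
have [r [F [_ _ QF1]]] := orthonormal_frame Qsym Qpos.
have QF : Q *m F^T *m F = 1%:M by rewrite -[RHS]QF1 ?mul1mx.
have BxE : ip B x x = \sum_k << x · row k F, x · row k F >>.
  rewrite BE /tform -[L x *m L x]mulmx1 -QF !mulmxA mxtrace_mulC !mulmxA.
  rewrite /mxtrace -sumrN; apply: eq_bigr => k _.
  by rewrite mulmx_gramE !row_mul !LE mul_skew opprK.
split; first by rewrite BxE sumr_ge0 // => k _; apply: norm_ge0.
move=> xx0; apply/kerP => y.
have xF k : x · row k F = 0.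
  apply: eq0_norm; move: xx0; rewrite BxE => /eqP; rewrite psumr_eq0 //.
  by move=> /allP/(_ k (mem_index_enum k))/eqP.
have FL : F *m L x = 0.
  by apply/row_matrixP => k; rewrite row_mul LE xF row0.
by rewrite -LE -[y]mulmx1 -QF -!mulmxA FL !mulmx0.
Qed.

Let W := kermx (Q *m ker^T).
Let WP x : reflect (forall a, (a <= ker)%MS -> << x, a >> = 0) (x <= W)%MS.
Proof.
apply: (iffP sub_kermxP) => [xW a /submxP[c ->]|xW].
  by rewrite /ip trmx_mul -!mulmxA (mulmxA Q) (mulmxA x) xW mul0mx mxE.
apply/rowP => j; rewrite mulmxA [RHS]mxE.
by rewrite mulmx_gramE row_id xW ?row_sub.
Qed.

Let W_ideal x y : (y <= W)%MS -> (x · y <= W)%MS.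
Proof.
by move=> /WP yW; apply/WP => a aK; rewrite mul_skew yW ?oppr0 // ker_ideal.
Qed.

Let W_bra x y : (x <= W)%MS -> (y <= W)%MS -> (bra x y <= W)%MS.
Proof. by move=> xW yW; rewrite addmx_sub ?eqmx_opp ?W_ideal. Qed.

(** A [B]-isotropic vector of [W] lies both in [ker] and in its [Q]-orthogonal. *)
Let B_posW : pos_on B W.
Proof.
move=> x xW; apply: contraNT; rewrite lt_neqAle (B_pos x).1 andbT negbK eq_sym.
by move=> /eqP/(B_pos x).2/(WP _ xW)/eq0_norm ->.
Qed.

(* With [e] orthonormal in [W] for the invariant form [B], the vector
   [w = \sum_k e_k e_k] satisfies [x w = C x] for [x] in [W], where
   [C = \sum_k L_{e_k}^2] is the Casimir operator. As [w w] is orthogonal to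
   [w], [C w] is too, which forces [e_k w = 0], then [C x = x w = 0]. *)
Let W_null x y : (x <= W)%MS -> (y <= W)%MS -> x · y = 0.
Proof.
have [r [E [EW EE WE]]] := orthonormal_frame Bsym B_posW.
pose e k := row k E.
have eW k : (e k <= W)%MS by apply: submx_trans (row_sub _ _) EW.
have eP z : (z <= W)%MS -> z = \sum_k ip B z (e k) *: e k.
  move=> zW; rewrite -{1}(WE _ z zW) mulmx_sum_row.
  by apply: eq_bigr => k _; rewrite mulmx_gramE row_id.
pose w := \sum_k e k · e k.
have wW : (w <= W)%MS by apply: summx_sub => k _; apply: W_ideal.
have casimir z : (z <= W)%MS -> z · w = \sum_k e k · (e k · z).
  move=> zW; pose a k l := ip B (bra z (e k)) (e l).
  (* Invariance of [B] makes the bracket with [z] antisymmetric in the frame [e]; this is what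
     cancels the bracket terms below. *)
  have aN k l : a k l = - a l k by rewrite /a B_inv ipC.
  have braE k : bra z (e k) = \sum_l a k l *: e l by apply/eP/W_bra.
  have -> : z · w = \sum_k (bra z (e k) · e k + e k · bra z (e k)
                            + e k · (e k · z)).
    rewrite mul_sumr; apply: eq_bigr => k _; rewrite mul_flat mulBr.
    by rewrite (addrA (_ - _)) !subrK.
  rewrite big_split /= big_split /=.
  have -> : \sum_k bra z (e k) · e k = - \sum_k e k · bra z (e k); last first.
    by rewrite addNr add0r.
  under eq_bigr do rewrite braE mul_suml.
  rewrite exchange_big -sumrN; apply: eq_bigr => k _ /=.
  rewrite braE mul_sumr -sumrN; apply: eq_bigr => l _.
  by rewrite mulZl mulZr aN scaleNr.
have sum0 z v : << \sum_k e k · (e k · z), v >> = - \sum_k << e k · z, e k · v >>.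
  by rewrite ip_suml -sumrN; apply: eq_bigr => k _; rewrite mul_skew.
(* By skewness [<<C z, z>>] is minus the sum of the squared norms of the [e k · z]. *)
have null_of z : << \sum_k e k · (e k · z), z >> = 0 ->
    forall v, (v <= W)%MS -> v · z = 0.
  rewrite sum0 => /eqP; rewrite oppr_eq0 psumr_eq0 // => /allP ez0 v vW.
  rewrite (eP _ vW) mul_suml big1 // => k _.
  have /eqP/eq0_norm ez : << e k · z, e k · z >> == 0.
    by apply: ez0; rewrite mem_index_enum.
  by rewrite mulZl ez scaler0.
have w_null v : (v <= W)%MS -> v · w = 0.
  apply: null_of; rewrite -casimir //.
  have : << w · w, w >> = - << w · w, w >> by rewrite {1}mul_skew ipC.
  lra.
move=> xW yW; apply: null_of xW.
by rewrite -casimir // w_null // ip0l.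
Qed.

(** Splitting [x] and [y] along [W] and [ker], only the product of a vector of [W] with one of [ker]
    survives in [x · y], and [ker] is a left ideal. *)
Lemma flat_euclidean_mul_null x y z : (x · y) · z = 0.
Proof.
have split (v : V) : exists c a, [/\ (a <= ker)%MS, v = c + a & (c <= W)%MS].
  have posK : pos_on Q ker by move=> u _; apply/Qpos/submx1.
  have [c [a [aK -> cK]]] := projection_split v Qsym posK.
  by exists c, a; split=> //; apply/WP.
have [c [a [/kerP a0 -> cW]]] := split x.
have [c' [a' [aK' -> cW']]] := split y.
apply/kerP: z; rewrite mulDl a0 addr0 mulDr W_null // add0r.
exact: ker_ideal.
Qed.

End FlatEuclidean.

(** * Positivity in Lorentzian signature *)

Section Lorentzian.
Variables (R : rcfType) (n : nat) (M : 'M[R]_n.+1).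
Hypothesis M_lor : is_lorentzian M.
Notation V := 'rV[R]_n.+1.

Lemma lorentzian_unit : M \in unitmx.
Proof.
have [_ [P [Pu PM]]] := M_lor.
have dd : lorentz_diag R n *m lorentz_diag R n = 1%:M.
  rewrite /lorentz_diag mulmx_diag -diag_const_mx; congr diag_mx.
  by apply/rowP => j; rewrite !mxE; case: ifP => _; rewrite ?mulrNN mulr1.
have [] := mulmx1_unit dd; rewrite -PM unitmx_mul => /andP[+ _] _.
by rewrite unitmx_mul => /andP[].
Qed.

(** [c] is the coordinate along the timelike vector of a diagonalizing basis. *)
Lemma lorentzian_hyperplane :
  exists2 c : V -> R, scalar c & forall x, c x = 0 -> x != 0 -> 0 < ip M x x.
Proof.
have [_ [P [Pu PM]]] := M_lor.
exists (fun x => (x *m invmx P) 0 0) => [a x y|x].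
  by rewrite mulmxDl -scalemxAl !mxE.
set y := x *m invmx P => y0 x0; have {}y0 : y 0 ord0 = 0 := y0.
have xE : x = y *m P by rewrite mulmxKV.
have -> : ip M x x = \sum_(i | i != ord0) y 0 i ^+ 2.
  rewrite /ip xE trmx_mul !mulmxA -(mulmxA y) -(mulmxA y) PM.
  rewrite /lorentz_diag mul_mx_diag mxE (bigD1 ord0) //= mxE [y^T _ _]mxE y0 !mul0r add0r.
  by apply: eq_bigr => i /negPf i0; rewrite !mxE i0 mulr1 expr2.
rewrite lt_neqAle sumr_ge0 ?andbT => [|i _]; last exact: sqr_ge0.
apply: contra_neq x0 => /esym/eqP; rewrite psumr_eq0 => [/allP yi0|i _]; last exact: sqr_ge0.
rewrite xE (_ : y = 0) ?mul0mx //; apply/rowP => i; rewrite [RHS]mxE.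
have [->//|i0] := eqVneq i ord0.
by have := yi0 i (mem_index_enum i); rewrite i0 sqrf_eq0 => /eqP.
Qed.

(** Otherwise the form would be nonpositive on the span of [s] and [x], which contains a nonzero
    vector of the hyperplane [c = 0]. *)
Lemma timelike_orthogonal_pos s x :
  ip M s s < 0 -> ip M x s = 0 -> x != 0 -> 0 < ip M x x.
Proof.
have Msym : M^T = M by case: M_lor.
move=> ss xs x0; have [c c_lin cpos] := lorentzian_hyperplane.
rewrite ltNge; apply/negP => xx.
have sx : ip M s x = 0 by rewrite ipC.
have c0 : c 0 = 0 by have := c_lin (-1) 0 0; rewrite addr0 scaler0 mulN1r addNr.
pose z := c x *: s + (- c s) *: x.
have cz : c z = 0.
  by have := c_lin (- c s) x 0; rewrite c0 !addr0 /z c_lin => ->; ring.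
have zs : ip M z s = c x * ip M s s by rewrite !ipE xs mulr0 addr0.
have zz : ip M z z = c x ^+ 2 * ip M s s + c s ^+ 2 * ip M x x.
  by rewrite !ipE xs sx; ring.
(* If [z = 0], pairing with [s] gives [c x = 0], and [x] itself is the vector sought. *)
have [z0|z0] := eqVneq z 0.
  move: zs; rewrite z0 ip0l => /esym/eqP.
  rewrite mulf_eq0 (lt_eqF ss) orbF => /eqP cx0.
  by have := cpos x cx0 x0; rewrite ltNge xx.
have := cpos z cz z0; rewrite zz.
have := sqr_ge0 (c x); have := sqr_ge0 (c s); nra.
Qed.

End Lorentzian.

(** * The Levi-Civita product and the derived algebra *)

Section LeviCivita.
Variables (R : rcfType) (n : nat) (M : 'M[R]_n.+1).
Notation V := 'rV[R]_n.+1.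
Variable br : V -> V -> V.
Hypothesis br_lie : is_lie_bracket br.
Hypothesis Msym : M^T = M.
Hypothesis Munit : M \in unitmx.

Local Notation "x · y" := (LC br M x y) (at level 40, left associativity).

Lemma br_anti x y : br x y = - br y x.
Proof. by case: br_lie => _ + _; apply. Qed.
Lemma br_linl z : linear (br^~ z).
Proof. by case: br_lie => + _ _ a u v; apply. Qed.
Lemma br_linr z : linear (br z).
Proof.
by move=> a u v; rewrite br_anti br_linl opprD -scalerN -!(br_anti z).
Qed.

Lemma ip_nondeg x y : (forall w, ip M x w = ip M y w) -> x = y.
Proof.
move=> xy; apply: (can_inj (mulmxK Munit)); apply/rowP => j.
have := xy (delta_mx 0 j).
by rewrite /ip trmx_delta -!colE !mxE.
Qed.

Lemma br_Dl x y z : br (x + y) z = br x z + br y z.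
Proof. by have := br_linl z 1 x y; rewrite !scale1r. Qed.
Lemma br_Dr x y z : br z (x + y) = br z x + br z y.
Proof. by have := br_linr z 1 x y; rewrite !scale1r. Qed.

(** [LC] imposes the Koszul formula on basis vectors; linearity in [w] extends it. *)
Lemma ip_LC u v w : ip M (u · v) w = lc_rhs br M u v w.
Proof.
rewrite [RHS]scalar_sum => [|a x y]; last first.
  by rewrite /lc_rhs br_linr br_linl !ipE; ring.
rewrite /ip /LC mulmxKV // mxE.
by apply: eq_bigr => j _; rewrite !mxE mulrC.
Qed.

Lemma LC_linl z : linear (fun x => x · z).
Proof.
move=> a x y; apply: ip_nondeg => w.
by rewrite !ipE !ip_LC /lc_rhs br_linl br_linr !ipE; ring.
Qed.
Lemma LC_linr x : linear (fun y => x · y).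
Proof.
move=> a y z; apply: ip_nondeg => w.
by rewrite !ipE !ip_LC /lc_rhs br_linl br_linr !ipE; ring.
Qed.

(** Metric compatibility: the Koszul expression is antisymmetric in its last two arguments. *)
Lemma LC_skew x y z : ip M (x · y) z = - ip M y (x · z).
Proof.
rewrite (ipC y) // !ip_LC /lc_rhs (br_anti z x) (br_anti z y) (br_anti y x) !ipE.
ring.
Qed.

Lemma LC_torsion x y : x · y - y · x = br x y.
Proof.
apply: ip_nondeg => w; rewrite !ipE !ip_LC /lc_rhs.
by rewrite (br_anti y x) (br_anti x w) (br_anti y w) !ipE; field.
Qed.

Lemma LC_Bl x y z : (x - y) · z = x · z - y · z.
Proof.
by have := LC_linl z (-1) y x; rewrite !scaleN1r ![- _ + _]addrC.
Qed.
Lemma LC_Dr x y z : z · (x + y) = z · x + z · y.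
Proof. by have := LC_linr z 1 x y; rewrite !scale1r. Qed.
Lemma LC_0r z : z · 0 = 0.
Proof. by apply/(addrI (z · 0)); rewrite -LC_Dr !addr0. Qed.

Lemma derived_br x y : inD br (br x y).
Proof.
have br_delta i z : (br (delta_mx 0 i) z <= derived br)%MS.
  rewrite (row_sum_delta z) -(mul_lin1_mx _ (br_linr _)) mulmx_suml.
  apply: summx_sub => j _; rewrite -scalemxAl scalemx_sub //.
  rewrite mul_lin1_mx; last exact: br_linr.
  rewrite /derived (sumsmx_sup i) // (sumsmx_sup j) // genmxE.
  exact: submx_refl.
rewrite /inD (row_sum_delta x) -(mul_lin1_mx _ (br_linl y)) mulmx_suml.
apply: summx_sub => j _; rewrite -scalemxAl scalemx_sub //.
by rewrite mul_lin1_mx; [exact: br_delta | exact: br_linl].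
Qed.

(** Any width of [K] is allowed, so as to test both scalar and vector-valued linear conditions on
    brackets alone. *)
Lemma derived_ann p (K : 'M[R]_(n.+1, p)) :
  (forall x y, br x y *m K = 0) -> forall d, inD br d -> d *m K = 0.
Proof.
move=> brK d dD; apply/sub_kermxP; apply: submx_trans dD _.
apply/sumsmx_subP => i _; apply/sumsmx_subP => j _.
by rewrite genmxE; apply/sub_kermxP.
Qed.

Lemma derived_ip s :
  (forall x y, ip M (br x y) s = 0) -> forall d, inD br d -> ip M d s = 0.
Proof.
move=> brs d dD; rewrite /ip -mulmxA (derived_ann _ dD) ?mxE // => x y.
by apply/rowP => j; rewrite ord1 mulmxA [RHS]mxE; apply: brs.
Qed.

Lemma derived_lin (f : V -> V) : linear f ->
  (forall x y, f (br x y) = 0) -> forall d, inD br d -> f d = 0.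
Proof.
move=> f_lin brf d dD; rewrite -(mul_lin1_mx _ f_lin) derived_ann // => x y.
by rewrite mul_lin1_mx.
Qed.

End LeviCivita.

(** * Lorentzian Lie algebras and the Killing condition *)

Section FlatLorentzian.
Variables (R : rcfType) (n : nat) (M : 'M[R]_n.+1).
Notation V := 'rV[R]_n.+1.
Variable br : V -> V -> V.
Hypothesis br_lie : is_lie_bracket br.
Hypothesis M_lor : is_lorentzian M.

Local Notation "x · y" := (LC br M x y) (at level 40, left associativity).
Local Notation "<< x , y >>" := (ip M x y).

Let Msym : M^T = M. Proof. by case: M_lor. Qed.
Let Munit : M \in unitmx. Proof. exact: lorentzian_unit. Qed.
Let skew := LC_skew br_lie Msym Munit.
Let torsion := LC_torsion br_lie Munit.
Let linl := LC_linl br_lie Munit.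
Let linr := LC_linr br_lie Munit.

Definition flat_splitting : Prop :=
  [/\ (forall x, exists s d, [/\ inS br M s, inD br d & x = s + d]) /\
        (forall x, inS br M x -> inD br x -> x = 0),
      (forall s d, inS br M s -> inD br d -> ip M s d = 0),
      (forall a b, inD br a -> inD br b -> br a b = 0),
      (forall a b, inS br M a -> inS br M b -> br a b = 0) &
      (exists u, inS br M u /\ ip M u u < 0)].

Lemma mul_self_orth x y : << x · y, y >> = 0.
Proof. have := skew x y y; rewrite (ipC y) //; lra. Qed.

(** [ad_s = L_s - R_s] and [L_s] is skew, so [R_s] is skew as well. *)
Lemma inS_mulr_skew s x y : inS br M s -> << x · s, y >> = - << x, y · s >>.
Proof.
by move=> /(_ x y); rewrite -!torsion !ipE skew; lra.
Qed.

Lemma parallel_inS s : (forall x, x · s = 0) -> inS br M s.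
Proof.
by move=> s0 v w; rewrite -!torsion !s0 !subr0 skew addNr.
Qed.

(** * From flatness and a timelike Killing vector to the splitting *)

Section Timelike.
Hypothesis flat : is_flat br M.
Variable s0 : V.
Hypothesis s0_S : inS br M s0.
Hypothesis s0_time : << s0, s0 >> < 0.

Let mul_flat x y z : (x · y - y · x) · z = x · (y · z) - y · (x · z).
Proof. by rewrite torsion; apply: subr0_eq; apply: flat. Qed.

Let eq0_orth x : << x, s0 >> = 0 -> << x, x >> = 0 -> x = 0.
Proof.
move=> xs xx; apply/eqP/negPn/negP.
by move/(timelike_orthogonal_pos M_lor s0_time xs); rewrite xx ltxx.
Qed.

(* Flatness gives [R_s R_s = [R_s, L_s]] for [s = s0], and [R_s], [L_s] are
   skew, so [<<x s, x s>> = - <<[R_s, L_s] x, x>> = 0], while [x s] lies in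
   the Euclidean space orthogonal to [s]. *)
Lemma timelike_killing_parallel x : x · s0 = 0.
Proof.
have ss : s0 · s0 = 0.
  apply: (ip_nondeg Munit) => w.
  by rewrite inS_mulr_skew // (ipC s0) // mul_self_orth oppr0 ip0l.
apply: eq0_orth; first exact: mul_self_orth.
have xss : (x · s0) · s0 = (s0 · x) · s0 - s0 · (x · s0).
  have := mul_flat x s0 s0; rewrite ss LC_0r // sub0r LC_Bl // => /eqP.
  by rewrite subr_eq addrC => /eqP.
rewrite inS_mulr_skew // xss !ipE (ipC x) // inS_mulr_skew //.
have := skew s0 x (x · s0); rewrite (ipC (s0 · x)) //; lra.
Qed.

(* Flipping the sign of [M] along [s0] yields a Euclidean product; as [s0] is
   parallel, the Levi-Civita product stays skew for it. *)
Lemma flat_timelike_mul_null x y z : (x · y) · z = 0.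
Proof.
(* This constant gives [Q = M] on the orthogonal of [s0] and [ip Q s0 s0 = - <<s0, s0>>]. *)
pose c := 2 / << s0, s0 >>.
pose Q := M - c *: (M *m s0^T *m (s0 *m M)).
have QE u v : ip Q u v = << u, v >> - c * (<< u, s0 >> * << s0, v >>).
  have -> : << u, s0 >> * << s0, v >> = ip (M *m s0^T *m (s0 *m M)) u v.
    rewrite [RHS]/ip (_ : _ *m v^T = (u *m M *m s0^T) *m (s0 *m M *m v^T)).
      by rewrite [RHS]mxE big_ord1.
    by rewrite !mulmxA.
  by rewrite /ip /Q mulmxBr mulmxBl -scalemxAr -scalemxAl [LHS]mxE !mxE.
have Qsym : Q^T = Q.
  by rewrite /Q linearB linearZ /= !trmx_mul trmxK Msym !mulmxA.
have Qpos : pos_on Q (1%:M : 'M_n.+1).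
  move=> u _ u0; rewrite QE (ipC s0) //.
  have [us|us] := eqVneq (<< u, s0 >>) 0.
    rewrite us !mulr0 subr0; exact: (timelike_orthogonal_pos M_lor s0_time us u0).
  (* [t *: s0] is the component of [u] along [s0], and [v] the orthogonal one. *)
  pose t := << u, s0 >> / << s0, s0 >>.
  pose v := u - t *: s0.
  have ts : t * << s0, s0 >> = << u, s0 >> by rewrite mulfVK // lt_eqF.
  have vs : << v, s0 >> = 0 by rewrite !ipE ts subrr.
  have vv : 0 <= << v, v >>.
    have [->|v0] := eqVneq v 0; first by rewrite ip0l.
    exact/ltW/(timelike_orthogonal_pos M_lor s0_time vs v0).
  have tt : t ^+ 2 * << s0, s0 >> < 0.
    rewrite pmulr_rlt0 // exprn_even_gt0 //= mulf_neq0 // invr_eq0.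
    by rewrite lt_eqF.
  have -> : << u, u >> - c * (<< u, s0 >> * << u, s0 >>)
            = << v, v >> - t ^+ 2 * << s0, s0 >>.
    have -> : c * (<< u, s0 >> * << u, s0 >>) = 2 * (t ^+ 2 * << s0, s0 >>).
      by rewrite /c /t; field; rewrite lt_eqF.
    by rewrite !ipE (ipC s0) // -ts; ring.
  lra.
apply: (flat_euclidean_mul_null Qsym Qpos linl linr) => // u v w.
(* The term added to [M] does not see the image of [L_u]. *)
have s0_orth v' : << u · v', s0 >> = 0.
  by rewrite skew timelike_killing_parallel ip0r oppr0.
by rewrite !QE skew (ipC s0 (u · w)) // !s0_orth; ring.
Qed.

Lemma flat_timelike_inS s : inS br M s <-> (forall x, x · s = 0).
Proof.
split=> [sS x|]; last exact: parallel_inS.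
apply: eq0_orth; first by rewrite skew timelike_killing_parallel ip0r oppr0.
by rewrite inS_mulr_skew // flat_timelike_mul_null ip0r oppr0.
Qed.

Let derived_orth s d : inS br M s -> inD br d -> << d, s >> = 0.
Proof.
move=> /flat_timelike_inS sS; move: d; apply: derived_ip => x y.
by rewrite -torsion !ipE !skew !sS !ip0r oppr0 subrr.
Qed.

Lemma flat_timelike_splitting : flat_splitting.
Proof.
(* [[g, g]] is orthogonal to [s0], hence Euclidean, and orthogonal projection onto it exists. *)
have Dpos : pos_on M (derived br).
  move=> d dD; apply: (timelike_orthogonal_pos M_lor s0_time _).
  exact: derived_orth.
have derived_null d z : inD br d -> d · z = 0.
  move: d; apply: (derived_lin (linl z) _) => x y.
  by rewrite -torsion LC_Bl // !flat_timelike_mul_null subrr.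
split.
- split=> [x|x /flat_timelike_inS xS xD].
    have [s [d [dD -> sD]]] := projection_split x Msym Dpos.
    exists s, d; split=> //; apply/flat_timelike_inS => y.
    apply: eq0_orth; first by rewrite skew timelike_killing_parallel ip0r oppr0.
    (* As [(y · s) · y = 0], the product [y · (y · s)] is a bracket, to which [s] is orthogonal. *)
    rewrite skew (_ : y · (y · s) = br y (y · s)).
      by rewrite sD ?oppr0 //; apply: derived_br.
    by rewrite -torsion flat_timelike_mul_null subr0.
  apply: (pos_on_eq0 Dpos xD); apply: derived_orth => //.
  exact/flat_timelike_inS.
- by move=> s d sS dD; rewrite ipC // derived_orth.
- by move=> a b aD bD; rewrite -torsion !derived_null ?subrr.
- move=> a b /flat_timelike_inS aS /flat_timelike_inS bS.
  by rewrite -torsion aS bS subrr.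
- by exists s0.
Qed.

End Timelike.

(** * From the splitting to the product, flatness and even dimension *)

Section Splitting.
Hypothesis split : flat_splitting.

Let br0r x : br x 0 = 0.
Proof. by apply/(addrI (br x 0)); rewrite -br_Dr ?addr0. Qed.
Let brNr x y : br x (- y) = - br x y.
Proof. by apply/(addrI (br x y)); rewrite -br_Dr // !subrr br0r. Qed.

(** In the Koszul formula [<<br v w, a>>] vanishes by orthogonality, and skewness of [ad_a] makes
    the other two terms equal. *)
Lemma splitting_LC_S a v : inS br M a -> a · v = br a v.
Proof.
have [_ orth _ _ _] := split => aS; apply: (ip_nondeg Munit) => w.
rewrite ip_LC // /lc_rhs; have := aS v w.
have := orth _ _ aS (derived_br br_lie v w).
rewrite (ipC a) // => ->; rewrite (br_anti br_lie w a) !ipE (ipC v) // => h.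
by rewrite (_ : << br a w, v >> = - << br a v, w >>); [field | lra].
Qed.

(** After splitting [v] and [w], the terms left in the Koszul formula cancel in pairs by skewness of
    [ad_s] and [ad_s']. *)
Lemma splitting_LC_D a v : inD br a -> a · v = 0.
Proof.
have [[dec _] orth abD abS _] := split => aD; apply: (ip_nondeg Munit) => w.
rewrite ip_LC // /lc_rhs ip0l.
have orthl s d : inS br M s -> inD br d -> << d, s >> = 0.
  by move=> *; rewrite ipC // orth.
have [s [d [sS dD ->]]] := dec v; have [s' [d' [sS' dD' ->]]] := dec w.
rewrite !(br_Dl br_lie, br_Dr br_lie) (abD a d) // (abD d' a) // (abD d d') //.
rewrite (abS s s') // !ipE.
rewrite !(orthl _ _ sS (derived_br br_lie _ _)).
rewrite !(orthl _ _ sS' (derived_br br_lie _ _)).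
have := sS a d'; have := sS' a d.
rewrite (br_anti br_lie a s) (br_anti br_lie d s') !ipE.
rewrite (ipC a (br s' d)) // (ipC a (br s d')) //; lra.
Qed.

(** [L] vanishes on brackets, and [L_u] is [ad_s] for the component [s] of [u] in [S(g)]; these
    commute by the Jacobi identity. *)
Lemma splitting_flat : is_flat br M.
Proof.
have [[dec _] _ abD abS _] := split.
move=> u v w; rewrite /curv splitting_LC_D; last exact: derived_br.
have [s [d [sS dD ->]]] := dec u; have [s' [d' [sS' dD' ->]]] := dec v.
have LE a b c : inS br M a -> inD br b -> (a + b) · c = br a c.
  move=> aS bD; have := linl c 1 a b; rewrite !scale1r => ->.
  by rewrite splitting_LC_S // splitting_LC_D // addr0.
rewrite !LE //; case: br_lie => _ _ /(_ s s' w).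
rewrite (abS _ _ sS sS') br0r addr0 (br_anti br_lie w s) brNr => ->.
by rewrite subrr.
Qed.

Lemma splitting_even : ~~ odd (\rank (derived br)).
Proof.
have [[dec triv] orth abD abS [s0 [s0_S s0_time]]] := split.
(* On the abelian [[g, g]], [ad_u] depends only on the [S(g)]-component of [u], so the basis of [g]
   can replace one of [S(g)]. *)
have brS u x : inD br x ->
    exists2 s, inS br M s & forall y, inD br y -> br u y = br s y.
  move=> xD; have [s [d [sS dD ->]]] := dec u; exists s => // y yD.
  by rewrite br_Dl // (abD _ _ dD) // addr0.
apply: (commuting_skew_even Msym
          (As := [seq lin1_mx (br (delta_mx 0 i)) | i : 'I_n.+1])).
- move=> d dD; apply: (timelike_orthogonal_pos M_lor s0_time).
  by rewrite ipC // orth.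
- move=> A /mapP[i _ ->] x xD; rewrite mul_lin1_mx; last exact: br_linr.
  exact: derived_br.
- move=> A /mapP[i _ ->] x y xD yD; rewrite !mul_lin1_mx; try exact: br_linr.
  have [s sS sE] := brS (delta_mx 0 i) x xD.
  by rewrite !sE //; have := sS x y; lra.
- move=> A B /mapP[i _ ->] /mapP[j _ ->] x xD.
  rewrite !mul_lin1_mx; try exact: br_linr.
  have [s sS sE] := brS (delta_mx 0 i) x xD.
  have [s' sS' sE'] := brS (delta_mx 0 j) x xD.
  rewrite !(sE, sE') //; try exact: derived_br.
  case: br_lie => _ _ /(_ s s' x).
  rewrite (abS _ _ sS sS') br0r addr0 (br_anti br_lie x s) brNr => /subr0_eq.
  by move->.
(* A vector killed by every [ad] is central, hence in [S(g)], which meets [[g, g]] trivially. *)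
- move=> x xD x0; apply: triv => // v w.
  have central u : br u x = 0.
    rewrite -(mul_lin1_mx u (br_linl br_lie x)) (_ : lin1_mx _ = 0) ?mulmx0 //.
    apply/matrixP => i j; rewrite !mxE -(mul_lin1_mx x (br_linr br_lie _)).
    by rewrite x0 ?mxE //; apply/mapP; exists i; rewrite ?mem_enum.
  by rewrite !(br_anti br_lie x) !central !oppr0 ip0l ip0r addr0.
Qed.

End Splitting.

End FlatLorentzian.

Theorem theorem1p1 (R : rcfType) (n : nat)
  (br : 'rV[R]_n.+1 -> 'rV[R]_n.+1 -> 'rV[R]_n.+1) (M : 'M[R]_n.+1)
  (Hbr : is_lie_bracket br) (HM : is_lorentzian M) :
  ((is_flat br M /\ exists u, inS br M u /\ ip M u u < 0)
   <->
   [/\ (forall x, exists s d, [/\ inS br M s, inD br d & x = s + d]) /\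
         (forall x, inS br M x -> inD br x -> x = 0),
       (forall s d, inS br M s -> inD br d -> ip M s d = 0),
       (forall a b, inD br a -> inD br b -> br a b = 0),
       (forall a b, inS br M a -> inS br M b -> br a b = 0) &
       (exists u, inS br M u /\ ip M u u < 0)])
  /\
  ([/\ (forall x, exists s d, [/\ inS br M s, inD br d & x = s + d]) /\
         (forall x, inS br M x -> inD br x -> x = 0),
       (forall s d, inS br M s -> inD br d -> ip M s d = 0),
       (forall a b, inD br a -> inD br b -> br a b = 0),
       (forall a b, inS br M a -> inS br M b -> br a b = 0) &
       (exists u, inS br M u /\ ip M u u < 0)] ->
   [/\ ~~ odd (\rank (derived br)),
       (forall a, inS br M a -> forall v, LC br M a v = br a v) &
       (forall a, inD br a -> forall v, LC br M a v = 0)]).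
Proof.
split; last first.
  move=> split; split=> *; first exact: (splitting_even Hbr HM split).
    exact: (splitting_LC_S Hbr HM split).
  exact: (splitting_LC_D Hbr HM split).
split=> [[flat [s0 [s0_S s0_time]]]|split].
  exact: (flat_timelike_splitting Hbr HM flat s0_S s0_time).
split; first exact: (splitting_flat Hbr HM split).
by case: split.
Qed.
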